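(* For any instance of the variable-group model (sets $N$ of $n$ agents and $M$ of $m$ goods, desired group sizes $n_1,\dots,n_k$ with $n_1+\dots+n_k=n$, and arbitrary normalized monotonic utility functions $u_a$, $a\in N$), there exists an EF1 outcome. Moreover, such an outcome can be computed in time $O(mn^3)$.
   Context: Variable-group model: let $k\ge 2$ and $n_1,\dots,n_k$ be positive integers, $N=[n]$ a set of $n=n_1+\dots+n_k$ agents, $M=[m]$ a set of $m$ goods. A bundle is a (possibly empty) subset of $M$. Each agent $a\in N$ has a utility function $u_a$ assigning a real number to each subset of $M$. Utilities are monotonic ($u_a(M')\le u_a(M'')$ whenever $M'\subseteq M''\subseteq M$) and normalized ($u_a(\emptyset)=0$). An algorithm can query any agent's utility for any set of goods in constant time. An allocation $A=(A_1,\dots,A_k)$ consists of $k$ disjoint bundles; it is complete if $A_1\cup\dots\cup A_k=M$. An outcome $(C,A)$ consists of a partition $C=(C_1,\dots,C_k)$ of the agents $N$ with $|C_i|=n_i$ for all $i\in[k]$, together with a complete allocation $A$ (bundle $A_i$ goes to group $C_i$, and every agent in $C_i$ derives her full utility from $A_i$). For a non-negative integer $c$, an outcome $(C,A)$ is EF$c$ (envy-free up to $c$ goods) if for all $i,j\in[k]$ and every $a\in C_i$ there is $B\subseteq A_j$ with $|B|\le c$ such that $u_a(A_i)\ge u_a(A_j\setminus B)$. EF1 is the case $c=1$. *)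

(* Defs.v *)
From HB Require Import structures.
From mathcomp Require Import all_boot all_order all_algebra reals.

Set Implicit Arguments.
Unset Strict Implicit.
Unset Printing Implicit Defensive.

Import Order.TTheory GRing.Theory Num.Theory.

Section Model.
Variable R : realType.

Definition normalized m (v : {set 'I_m} -> R) : Prop := v set0 = 0%R.

Definition monotonic m (v : {set 'I_m} -> R) : Prop :=
  forall S T : {set 'I_m}, S \subset T -> (v S <= v T)%R.

Record instance := Instance {
  groups : nat;
  agents : nat;
  goods : nat;
  group_size : 'I_groups -> nat;
  utility : 'I_agents -> {set 'I_goods} -> R;
  groups_ge2 : 2 <= groups;
  group_size_gt0 : forall i, 0 < group_size i;
  agentsE : agents = \sum_(i < groups) group_size i;
  utility_normalized : forall a, normalized (utility a);
  utility_monotonic : forall a, monotonic (utility a)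
}.

Definition agent_partition (I : instance)
    (C : 'I_(groups I) -> {set 'I_(agents I)}) : Prop :=
  [/\ forall i j, i != j -> [disjoint C i & C j],
      \bigcup_i C i = [set: 'I_(agents I)] &
      forall i, #|C i| = group_size i].

Definition allocation (I : instance)
    (A : 'I_(groups I) -> {set 'I_(goods I)}) : Prop :=
  forall i j, i != j -> [disjoint A i & A j].

Definition complete (I : instance)
    (A : 'I_(groups I) -> {set 'I_(goods I)}) : Prop :=
  \bigcup_i A i = [set: 'I_(goods I)].

Definition is_outcome (I : instance)
    (C : 'I_(groups I) -> {set 'I_(agents I)})
    (A : 'I_(groups I) -> {set 'I_(goods I)}) : Prop :=
  [/\ agent_partition C, allocation A & complete A].

Definition EF (c : nat) (I : instance)
    (C : 'I_(groups I) -> {set 'I_(agents I)})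
    (A : 'I_(groups I) -> {set 'I_(goods I)}) : Prop :=
  forall (i j : 'I_(groups I)) (a : 'I_(agents I)), a \in C i ->
    exists B : {set 'I_(goods I)},
      [/\ B \subset A j, #|B| <= c & (utility a (A j :\: B) <= utility a (A i))%R].

End Model.

(* Unit-cost random access machine with a utility oracle, programmed in a
   structured imperative language.  A program is a finite syntactic object that
   does not depend on the instance.  The only arithmetic is addition and
   truncated subtraction of naturals, so unit costs cannot be exploited to
   manipulate very long numbers; utilities can only be obtained from the oracle
   and compared.  An expression or a test costs one unit whatever its length:
   the lengths are bounded by a constant of the program. *)

Inductive expr :=
  | Const of nat
  | Reg of nat
  | Mem of expr
  | Add of expr & expr
  | Sub of expr & expr.

(* [TReal e1 e2] tests whether the utility stored in real cell [e1] is at most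
   the one stored in real cell [e2]. *)
Inductive test :=
  | TNat of expr & expr
  | TReal of expr & expr
  | TNot of test
  | TAnd of test & test.

(* [Query d a p] writes to the real cell of address [d] the utility, for the
   agent of index [a], of the set of goods whose characteristic vector is stored
   in the cells [p], ..., [p + m - 1] (a good is in the set when its cell is
   nonzero).  It costs one unit, and blocks if [a] is not an agent. *)
Inductive prog :=
  | Skip
  | SetReg of nat & expr
  | SetMem of expr & expr
  | Query of expr & expr & expr
  | Seq of prog & prog
  | If of test & prog & prog
  | While of test & prog.

Section Machine.
Variable R : realType.

Record state := State {
  regs : nat -> nat;
  mem : nat -> nat;
  vals : nat -> R
}.

Definition upd (T : Type) (f : nat -> T) (x : nat) (v : T) : nat -> T :=
  fun y => if y == x then v else f y.

Fixpoint eval (s : state) (e : expr) : nat :=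
  match e with
  | Const c => c
  | Reg x => regs s x
  | Mem e1 => mem s (eval s e1)
  | Add e1 e2 => eval s e1 + eval s e2
  | Sub e1 e2 => eval s e1 - eval s e2
  end.

Fixpoint holds (s : state) (b : test) : bool :=
  match b with
  | TNat e1 e2 => eval s e1 <= eval s e2
  | TReal e1 e2 => (vals s (eval s e1) <= vals s (eval s e2))%R
  | TNot b1 => ~~ holds s b1
  | TAnd b1 b2 => holds s b1 && holds s b2
  end.

(* [exec u p s s' t]: with oracle [u], [p] started in [s] halts in [s'] after
   [t] time units. *)
Inductive exec n m (u : 'I_n -> {set 'I_m} -> R) :
    prog -> state -> state -> nat -> Prop :=
  | ExecSkip s : exec u Skip s s 1
  | ExecSetReg s x e :
      exec u (SetReg x e) s
        (State (upd (regs s) x (eval s e)) (mem s) (vals s)) 1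
  | ExecSetMem s d e :
      exec u (SetMem d e) s
        (State (regs s) (upd (mem s) (eval s d) (eval s e)) (vals s)) 1
  | ExecQuery s d e p (a : 'I_n) : eval s e = a ->
      exec u (Query d e p) s
        (State (regs s) (mem s)
           (upd (vals s) (eval s d)
              (u a [set g : 'I_m | mem s (eval s p + g) != 0]))) 1
  | ExecSeq p q s s1 s2 t1 t2 :
      exec u p s s1 t1 -> exec u q s1 s2 t2 -> exec u (Seq p q) s s2 (t1 + t2)
  | ExecIfTrue b p q s s1 t :
      holds s b -> exec u p s s1 t -> exec u (If b p q) s s1 t.+1
  | ExecIfFalse b p q s s1 t :
      ~~ holds s b -> exec u q s s1 t -> exec u (If b p q) s s1 t.+1
  | ExecWhileTrue b p s s1 s2 t1 t2 :
      holds s b -> exec u p s s1 t1 -> exec u (While b p) s1 s2 t2 ->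
      exec u (While b p) s s2 (t1 + t2).+1
  | ExecWhileFalse b p s : ~~ holds s b -> exec u (While b p) s s 1.

(* Input: registers 0, 1, 2 hold the numbers of agents, of goods and of groups,
   memory cell [i] the desired size of group [i]; everything else is zero. *)
Definition input (I : instance R) : state :=
  State (nth 0 [:: agents I; goods I; groups I])
        (fun x => oapp (@group_size R I) 0 (insub x))
        (fun=> 0%R).

(* Output: registers 0 and 1 hold the base addresses of two arrays, giving the
   group of each agent and the group receiving each good. *)
Definition output_groups (I : instance R) (s : state) (i : 'I_(groups I)) :
    {set 'I_(agents I)} :=
  [set a : 'I_(agents I) | mem s (regs s 0 + a) == i].

Definition output_bundles (I : instance R) (s : state) (i : 'I_(groups I)) :
    {set 'I_(goods I)} :=
  [set g : 'I_(goods I) | mem s (regs s 1 + g) == i].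

(* Makes "the" final state and "the" running time meaningful. *)
Lemma exec_det n m (u : 'I_n -> {set 'I_m} -> R) p s s1 s2 t1 t2 :
  exec u p s s1 t1 -> exec u p s s2 t2 -> s1 = s2 /\ t1 = t2.
Proof.
move=> H; elim: H s2 t2 => {p s s1 t1}.
- by move=> s s2 t2 H; inversion H.
- by move=> s x e s2 t2 H; inversion H.
- by move=> s d e s2 t2 H; inversion H.
- move=> s d e p a ea s2 t2 H; inversion H as [| | |? ? ? ? b eb| | | | |]; subst.
  by have -> : b = a by apply: val_inj; rewrite /= -ea -eb.
- move=> p q s s1 s2 t1 t2 _ IH1 _ IH2 s3 t3 H; inversion H; subst.
  by case: (IH1 _ _ ltac:(eassumption)) => ? ?; subst;
     case: (IH2 _ _ ltac:(eassumption)) => ? ?; subst.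
- move=> b p q s s1 t hb _ IH s2 t2 H; inversion H; subst.
    by case: (IH _ _ ltac:(eassumption)) => ? ?; subst.
  by match goal with h : is_true (~~ holds _ _) |- _ => rewrite hb in h end.
- move=> b p q s s1 t /negP hb _ IH s2 t2 H; inversion H; subst; first by [].
  by case: (IH _ _ ltac:(eassumption)) => ? ?; subst.
- move=> b p s s1 s2 t1 t2 hb _ IH1 _ IH2 s3 t3 H; inversion H; subst.
    by case: (IH1 _ _ ltac:(eassumption)) => ? ?; subst;
       case: (IH2 _ _ ltac:(eassumption)) => ? ?; subst.
  by match goal with h : is_true (~~ holds _ _) |- _ => rewrite hb in h end.
- move=> b p s /negP hb s2 t2 H; inversion H; subst; last by [].
  by [].
Qed.

End Machine.

Arguments input {R} I.
Arguments output_groups {R} I s i.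
Arguments output_bundles {R} I s i.

(* Main.v *)
(* Envy-cycle elimination, with agents moving between the bundles.  Allocate the
   goods one by one.  Draw an edge from bundle [i] to bundle [j] when an agent
   of group [i] prefers bundle [j].  If some bundle has no incoming edge, it
   receives the next good: removing that good cancels any new envy.  Otherwise
   following edges backwards closes a cycle, and moving one agent along every
   edge of the cycle keeps the group sizes, leaves the bundles unchanged and
   makes the moved agents happier, so EF1 is preserved.

   Running time: the number of pairs (agent, bundle she envies) grows by at most
   [n] for every good, and every rotation decreases it, so there are at most
   [m (n + 1)] rounds.  A round asks, for every bundle, which agents envy it,
   in time [O(n k)]. *)

From mathcomp Require Import all_boot all_order all_algebra reals.
From mathcomp Require Import zify.
(* After [all_boot], whose [mem] would otherwise hide the memory of a state. *)
Require Import Defs.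

Set Implicit Arguments.
Unset Strict Implicit.
Unset Printing Implicit Defensive.

Import Order.TTheory GRing.Theory Num.Theory.

(** * Moving agents and giving goods *)

Section EnvyCycles.
Variables (R : realType) (n m k : nat) (u : 'I_n -> {set 'I_m} -> R).
Implicit Types (own : 'I_n -> 'I_k) (A : 'I_k -> {set 'I_m}) (a : 'I_n).
Implicit Types (al : 'I_m -> 'I_k).

Definition envies own A a : pred 'I_k :=
  fun j => (u a (A (own a)) < u a (A j))%R.

Definition ef1 own A : Prop :=
  forall a j, exists B : {set 'I_m},
    [/\ B \subset A j, #|B| <= 1 & (u a (A j :\: B) <= u a (A (own a)))%R].

Definition envy_count own A : nat := \sum_a #|envies own A a|.

Definition move own a j : 'I_n -> 'I_k := fun b => if b == a then j else own b.

(** A partial allocation encoded by a total map: the values of [al] at goods from [r] on are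
    ignored. *)
Definition bundle al r j : {set 'I_m} := [set g : 'I_m | (g < r) && (al g == j)].

Definition give al (g : 'I_m) j : 'I_m -> 'I_k :=
  fun h => if h == g then j else al h.

(** The bundles stay fixed, and the only agent who moves gets a bundle she strictly prefers, so the
    old witnesses [B] still work. *)
Lemma ef1_move own A a j : ef1 own A -> envies own A a j ->
  ef1 (move own a j) A.
Proof.
move=> ef env b i; have [B [sB cB leB]] := ef b i; exists B; split=> //.
rewrite /move; case: eqP => // eqb; subst b.
exact/(le_trans leB)/ltW.
Qed.

(** By transitivity the mover envies only bundles she envied before, and no longer [j], which is now
    hers; nobody else is affected. *)
Lemma envy_count_move own A a j : envies own A a j ->
  envy_count (move own a j) A < envy_count own A.
Proof.
move=> env; rewrite /envy_count (bigD1 a) //= [X in _ < X](bigD1 a) //=.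
rewrite -addSn; apply: leq_add; last first.
  apply: leq_sum => b nba; apply/subset_leq_card/subsetP => i.
  by rewrite unfold_in /envies /move (negPf nba).
apply/proper_card/properP; split.
  apply/subsetP => i; rewrite unfold_in /envies /move eqxx.
  exact: lt_trans.
by exists j; rewrite // unfold_in /envies /move eqxx ltxx.
Qed.

(** The additive form avoids truncated subtraction and telescopes along a cycle of moves. *)
Lemma card_move own a j i :
  #|[set b | move own a j b == i]| + (i == own a) =
  #|[set b | own b == i]| + (i == j).
Proof.
rewrite -!sum1dep_card big_mkcond [in RHS]big_mkcond /=.
rewrite (bigD1 a) //= [in RHS](bigD1 a) //=.
rewrite (eq_bigr (fun b => if own b == i then 1 else 0)); last first.
  by move=> b nba; rewrite /move (negPf nba).
rewrite /move eqxx (eq_sym i j) (eq_sym i (own a)).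
by case: (j == i); case: (own a == i) => /=; lia.
Qed.

Lemma bundle_give al (g : 'I_m) j i :
  bundle (give al g j) g.+1 i =
  if i == j then g |: bundle al g j else bundle al g i.
Proof.
apply/setP => h; rewrite (fun_if (fun X : {set 'I_m} => h \in X)) !inE /give ltnS.
rewrite [h <= g]leq_eqVlt -(inj_eq val_inj h g).
have [->|nij] := eqVneq i j; case: (ltngtP h g) => //= _.
  by rewrite eqxx.
by rewrite eq_sym (negPf nij).
Qed.

Section Give.
Variables (own : 'I_n -> 'I_k) (al : 'I_m -> 'I_k) (g : 'I_m) (j : 'I_k).
Hypothesis umono : forall a, monotonic (u a).
Hypothesis unenvied : forall a, ~~ envies own (bundle al g) a j.

Lemma bundle_give_sub i : bundle al g i \subset bundle (give al g j) g.+1 i.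
Proof. by rewrite bundle_give; case: eqP => // ->; rewrite subsetUr. Qed.

(** Removing [g] from bundle [j] gives back a bundle nobody envied; the other bundles are unchanged,
    and an agent's own bundle can only grow. *)
Lemma ef1_give : ef1 own (bundle al g) ->
  ef1 own (bundle (give al g j) g.+1).
Proof.
move=> ef a i; have le_own := umono a (bundle_give_sub (own a)).
have [->|nij] := eqVneq i j.
  exists [set g]; split; rewrite ?cards1 // bundle_give eqxx.
    by rewrite sub1set setU11.
  apply: le_trans le_own.
  have := unenvied a; rewrite /envies -leNgt; apply: le_trans.
  by apply: umono; rewrite setDUl setDv set0U subsetDl.
have [B [sB cB leB]] := ef a i; exists B.
rewrite bundle_give (negPf nij); split=> //.
exact: le_trans le_own.
Qed.

(** Bundle [j] is the only one that an agent can start to envy. *)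
Lemma envy_count_give :
  envy_count own (bundle (give al g j) g.+1) <= envy_count own (bundle al g) + n.
Proof.
rewrite /envy_count -[X in _ + X]card_ord -sum1_card -big_split /=.
apply: leq_sum => a _.
apply: (@leq_trans #|[predU1 j & envies own (bundle al g) a]|); last first.
  by rewrite cardU1 addnC leq_add2l; case: (_ \notin _).
apply/subset_leq_card/subsetP => i.
rewrite !inE unfold_in /envies => lti; have [//|nij] := eqVneq i j.
rewrite unfold_in; apply: le_lt_trans (umono a (bundle_give_sub _)) _.
by move: lti; rewrite [X in (_ < u a X)%R]bundle_give (negPf nij).
Qed.

End Give.

Lemma bundle0 al j : bundle al 0 j = set0.
Proof. by apply/setP => g; rewrite !inE. Qed.

Lemma ef1_empty own al : ef1 own (bundle al 0).
Proof. by move=> a j; exists set0; rewrite !bundle0 setD0 sub0set cards0. Qed.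

Lemma envy_count_empty own al : envy_count own (bundle al 0) = 0.
Proof.
apply: big1 => a _; apply: eq_card0 => j.
by rewrite unfold_in /envies !bundle0 ltxx.
Qed.

End EnvyCycles.

(** * Eventual periodicity of a self-map of a finite set *)

Section Periodic.
Variables (k : nat) (f : 'I_k -> 'I_k).

(** Pigeonhole: among the iterates 0 to [k] two coincide, at [i < j]; from the [i]-th on, hence from
    the [k]-th on, [j - i] is a period. *)
Lemma iter_card_periodic x : exists2 L, 0 < L <= k & iter L f (iter k f x) = iter k f x.
Proof.
have /injectivePn[i [j nij eqij]] : ~~ injectiveb (fun i : 'I_k.+1 => iter i f x).
  apply/negP => /injectiveP /leq_card; rewrite !card_ord; lia.
wlog lij : i j nij eqij / i < j.
  move=> H; case: (ltngtP i j); [exact: H| |].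
    by apply: H; rewrite 1?eq_sym.
  by move=> e; rewrite (val_inj e) eqxx in nij.
exists (j - i); first by have := ltn_ord j; lia.
have lk : i <= k by rewrite -ltnS.
rewrite -iterD (_ : j - i + k = k - i + j); last lia.
by rewrite iterD -eqij -iterD subnK.
Qed.

(** Applying [f] another [L - j.+1] times to a coincidence would return to [x] after [L - (j - i)]
    steps, against minimality. *)
Lemma iter_inj_period x L : 0 < L -> iter L f x = x ->
  (forall l, 0 < l < L -> iter l f x != x) ->
  forall i j, i < j < L -> iter i.+1 f x != iter j.+1 f x.
Proof.
move=> L0 LE Lmin i j /andP[ij jL]; apply/eqP => e.
have := Lmin (L - (j - i)) ltac:(lia); apply/negP/negPn.
rewrite (_ : L - (j - i) = L - j.+1 + i.+1); last lia.
by rewrite iterD e -iterD subnK // LE.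
Qed.

End Periodic.

(** * Moving one agent along every edge of a cycle *)

Section Rotation.
Variables (R : realType) (n m k : nat) (u : 'I_n -> {set 'I_m} -> R).
Variables (own : 'I_n -> 'I_k) (A : 'I_k -> {set 'I_m}) (P : 'I_k -> 'I_n).
Variables (x : 'I_k) (L : nat).
Hypothesis P_envies : forall j, envies u own A (P j) j.
Let f := own \o P.
Hypotheses (L_gt0 : 0 < L) (L_period : iter L f x = x)
  (L_min : forall l, 0 < l < L -> iter l f x != x).

(* Assignment of the agents after [l] moves along the cycle of [f] through [x]. *)
Fixpoint rotated l : 'I_n -> 'I_k :=
  if l is l'.+1 then move (rotated l') (P (iter l' f x)) (iter l' f x) else own.

(** The original groups of the agents on the cycle are distinct, so these agents are distinct too,
    and the first [l] moves have not touched the [t]-th one. *)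
Lemma rotated_unmoved l t : l <= t < L ->
  rotated l (P (iter t f x)) = iter t.+1 f x.
Proof.
elim: l t => [|l IH] t /andP[lt tL]; first by rewrite iterS.
rewrite /= /move; case: eqP => [eP|_]; last by apply: IH; lia.
have := @iter_inj_period _ f x L L_gt0 L_period L_min l t ltac:(lia).
by rewrite !iterS /f /= eP eqxx.
Qed.

Lemma rotated_envies l : l < L ->
  envies u (rotated l) A (P (iter l f x)) (iter l f x).
Proof.
move=> lL; rewrite /envies rotated_unmoved ?leqnn // iterS.
exact: P_envies.
Qed.

Lemma ef1_rotated l : ef1 u own A -> l <= L -> ef1 u (rotated l) A.
Proof.
move=> ef; elim: l => //= l IH lL; apply: ef1_move; last exact: rotated_envies.
by apply: IH; lia.
Qed.

Lemma envy_count_rotated l : l <= L ->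
  envy_count u (rotated l) A + l <= envy_count u own A.
Proof.
elim: l => [|l IH] lL; first by rewrite addn0.
by have := envy_count_move (rotated_envies lL); have := IH ltac:(lia); rewrite /=; lia.
Qed.

(** The moves telescope: so far group [x] has gained a member and the group at the current end of
    the path has lost one. Closing the cycle cancels both. *)
Lemma card_rotated l i : l <= L ->
  #|[set b | rotated l b == i]| + (i == iter l f x) =
  #|[set b | own b == i]| + (i == x).
Proof.
elim: l => [//|l IH] lL.
have := card_move (rotated l) (P (iter l f x)) (iter l f x) i.
rewrite rotated_unmoved ?leqnn // [rotated l.+1]/=.
by have := IH ltac:(lia); lia.
Qed.

Lemma card_rotated_period i : #|[set b | rotated L b == i]| = #|[set b | own b == i]|.
Proof. by have := card_rotated i (leqnn L); rewrite L_period => /addIn. Qed.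

End Rotation.

(** * Weakest preconditions with running time *)

Lemma upd_neq T (f : nat -> T) x v y : y <> x -> upd f x v y = f y.
Proof. by rewrite /upd; case: eqP. Qed.

Lemma upd_eq T (f : nat -> T) x v y : y = x -> upd f x v y = v.
Proof. by rewrite /upd => ->; rewrite eqxx. Qed.

Definition For (x : nat) (e : expr) (p : prog) : prog :=
  Seq (SetReg x (Const 0))
      (While (TNot (TNat e (Reg x))) (Seq p (SetReg x (Add (Reg x) (Const 1))))).

Section WeakestPreconditions.
Variables (R : realType) (n m : nat) (u : 'I_n -> {set 'I_m} -> R).
Implicit Types (p q : prog) (s : state R) (Q : state R -> nat -> Prop).

Definition set_reg s x v : state R := State (upd (regs s) x v) (mem s) (vals s).

(** Total correctness: termination is part of the claim, and the postcondition sees the cost. *)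
Definition wp p s Q := exists s' t, exec u p s s' t /\ Q s' t.

Lemma wp_weaken p s Q1 Q2 :
  wp p s Q1 -> (forall s' t, Q1 s' t -> Q2 s' t) -> wp p s Q2.
Proof. by move=> [s' [t [ex q1]]] imp; exists s', t; split; [|exact: imp]. Qed.

Lemma wp_skip s Q : Q s 1 -> wp Skip s Q.
Proof. by exists s, 1; split=> //; constructor. Qed.

Lemma wp_setreg s x e Q : Q (set_reg s x (eval s e)) 1 -> wp (SetReg x e) s Q.
Proof. by eexists; eexists; split; [constructor|]. Qed.

Lemma wp_setmem s d e Q :
  Q (State (regs s) (upd (mem s) (eval s d) (eval s e)) (vals s)) 1 ->
  wp (SetMem d e) s Q.
Proof. by eexists; eexists; split; [constructor|]. Qed.

Lemma wp_query s d e b (a : 'I_n) Q : eval s e = a ->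
  Q (State (regs s) (mem s)
       (upd (vals s) (eval s d)
          (u a [set g : 'I_m | mem s (eval s b + g) != 0]))) 1 ->
  wp (Query d e b) s Q.
Proof. by eexists; eexists; split; [constructor; eassumption|]. Qed.

Lemma wp_seq p q s Q :
  wp p s (fun s1 t1 => wp q s1 (fun s2 t2 => Q s2 (t1 + t2))) ->
  wp (Seq p q) s Q.
Proof.
move=> [s1 [t1 [ex1 [s2 [t2 [ex2 qq]]]]]].
by exists s2, (t1 + t2); split=> //; apply: ExecSeq ex1 ex2.
Qed.

Lemma wp_if b p q s Q :
  (holds s b -> wp p s (fun s' t => Q s' t.+1)) ->
  (~~ holds s b -> wp q s (fun s' t => Q s' t.+1)) -> wp (If b p q) s Q.
Proof.
case: (boolP (holds s b)) => hb yes no.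
  have [s' [t [ex qq]]] := yes isT.
  by exists s', t.+1; split=> //; apply: ExecIfTrue.
have [s' [t [ex qq]]] := no isT.
by exists s', t.+1; split=> //; apply: ExecIfFalse.
Qed.

(* The index of [Inv] is a bound on the number of remaining iterations. *)
Lemma wp_while (Inv : nat -> state R -> Prop) b p T i s Q :
  (forall i s, Inv i s -> holds s b ->
     wp p s (fun s' t => t <= T /\ exists2 j, j < i & Inv j s')) ->
  Inv i s ->
  (forall s' t j, Inv j s' -> ~~ holds s' b -> t <= i * T.+1 + 1 -> Q s' t) ->
  wp (While b p) s Q.
Proof.
move=> body; elim/ltn_ind: i s Q => i IH s Q inv post.
case: (boolP (holds s b)) => hb; last first.
  exists s, 1; split; first exact: ExecWhileFalse.
  by apply: post inv hb _; lia.
have [s1 [t1 [ex1 [t1T [j ltji inv1]]]]] := body _ _ inv hb.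
have [|s2 [t2 [ex2 qq]]] :=
  IH _ ltji s1 (fun s' t2 => Q s' (t1 + t2).+1) inv1.
  move=> s' t j' inv' nb tb; apply: post inv' nb _.
  have : j.+1 * T.+1 <= i * T.+1 by rewrite leq_mul2r ltji orbT.
  lia.
by exists s2, (t1 + t2).+1; split=> //; apply: ExecWhileTrue ex1 ex2.
Qed.

(** Each iteration pays 2 more than its body, for the test and the increment; the last 2 are the
    initialisation and the failing test. The bound [e] is evaluated anew each time, so the invariant
    must fix its value. *)
Lemma wp_for (Inv : nat -> state R -> Prop) N T x e p s Q :
  (forall i s, Inv i s -> eval s e = N) ->
  (forall i s, i < N -> regs s x = i -> Inv i s ->
     wp p s (fun s' t =>
       [/\ t <= T, regs s' x = i & Inv i.+1 (set_reg s' x i.+1)])) ->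
  Inv 0 (set_reg s x 0) ->
  (forall s' t, Inv N s' -> t <= N * (T + 2) + 2 -> Q s' t) ->
  wp (For x e p) s Q.
Proof.
move=> evalN body init post; apply/wp_seq/wp_setreg => /=.
pose I d s' := exists i, [/\ i <= N, regs s' x = i, Inv i s' & d = N - i].
apply: (@wp_while I _ _ T.+1 N) => [d s1 [i [iN xi inv ->]]| |].
- rewrite /= (evalN _ _ inv) xi -ltnNge => ltiN.
  apply/wp_seq/(wp_weaken (body i s1 ltiN xi inv)) => s2 t2 [t2T x2 inv2].
  apply/wp_setreg; split; first lia.
  exists (N - i.+1); first lia.
  rewrite /= x2 addn1; exists i.+1; split=> //.
  by rewrite /= upd_eq.
- by exists 0; split; rewrite ?subn0 //= upd_eq.
- move=> s1 t j [i [iN xi inv _]].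
  rewrite /= (evalN _ _ inv) xi -ltnNge -leqNgt => leNi tb; apply: post.
    by have <- : i = N by lia.
  lia.
Qed.

End WeakestPreconditions.

(** * The program *)

(* Memory: group sizes in [0, k), addresses of the bundles in [k, 2k), for every
   bundle an agent envying it in [2k, 3k), the owner of each good in
   [3k, 3k + m), the group of each agent in [3k + m, 3k + m + n), and then the
   [k] characteristic vectors of the bundles, [m] cells each.
   Registers: 0, 1, 2 hold [n], [m], [k]; 3, 4, 5, 6 the addresses [2k], [3k],
   [3k + m], [3k + m + n]; 7 the number of goods already allocated; 8 an
   unenvied bundle, or [k]; 10 an agent envying bundle 9, or [n]; 12 the current
   bundle of the walk and of the rotation, which started at bundle 14.  The
   others are counters. *)

Definition at_ptr (x : nat) (e : expr) : expr := Mem (Add (Reg x) e).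

Definition scan : prog :=
  Seq (SetReg 10 (Reg 0))
      (For 11 (Reg 0)
        (Seq (Query (Const 0) (Reg 11) (at_ptr 2 (at_ptr 5 (Reg 11))))
        (Seq (Query (Const 1) (Reg 11) (at_ptr 2 (Reg 9)))
             (If (TReal (Const 1) (Const 0)) Skip (SetReg 10 (Reg 11)))))).

Definition search : prog :=
  Seq (SetReg 8 (Reg 2))
      (For 9 (Reg 2)
        (Seq scan
        (Seq (SetMem (Add (Reg 3) (Reg 9)) (Reg 10))
             (If (TNat (Reg 0) (Reg 10)) (SetReg 8 (Reg 9)) Skip)))).

Definition place : prog :=
  Seq (SetMem (Add (at_ptr 2 (Reg 8)) (Reg 7)) (Const 1))
  (Seq (SetMem (Add (Reg 4) (Reg 7)) (Reg 8))
       (SetReg 7 (Add (Reg 7) (Const 1)))).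

(* After [k] backward steps from any bundle, the current bundle is on a cycle. *)
Definition walk : prog :=
  Seq (SetReg 12 (Const 0))
      (For 9 (Reg 2) (SetReg 12 (at_ptr 5 (at_ptr 3 (Reg 12))))).

Definition rotate_step : prog :=
  Seq (SetReg 11 (at_ptr 3 (Reg 12)))
  (Seq (SetReg 13 (at_ptr 5 (Reg 11)))
  (Seq (SetMem (Add (Reg 5) (Reg 11)) (Reg 12))
       (SetReg 12 (Reg 13)))).

(** The first step precedes the loop because the exit test, being back at the starting bundle, would
    hold at once. *)
Definition rotate : prog :=
  Seq (SetReg 14 (Reg 12))
  (Seq rotate_step
       (While (TNot (TAnd (TNat (Reg 12) (Reg 14)) (TNat (Reg 14) (Reg 12))))
              rotate_step)).

Definition body : prog :=
  Seq search (If (TNat (Reg 2) (Reg 8)) (Seq walk rotate) place).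

Definition set_bases : prog :=
  Seq (SetReg 3 (Add (Reg 2) (Reg 2)))
  (Seq (SetReg 4 (Add (Reg 3) (Reg 2)))
  (Seq (SetReg 5 (Add (Reg 4) (Reg 1)))
       (SetReg 6 (Add (Reg 5) (Reg 0))))).

(** The machine has no multiplication: the addresses [vec_base + j * m] are accumulated by additions
    and tabulated. *)
Definition set_pointers : prog :=
  Seq (SetReg 13 (Reg 6))
      (For 9 (Reg 2)
        (Seq (SetMem (Add (Reg 2) (Reg 9)) (Reg 13))
             (SetReg 13 (Add (Reg 13) (Reg 1))))).

Definition assign_agents : prog :=
  Seq (SetReg 12 (Const 0))
      (For 9 (Reg 2)
        (For 11 (Mem (Reg 9))
          (Seq (SetMem (Add (Reg 5) (Reg 12)) (Reg 9))
               (SetReg 12 (Add (Reg 12) (Const 1)))))).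

Definition envy_cycle_elimination : prog :=
  Seq set_bases
  (Seq assign_agents
  (Seq set_pointers
  (Seq (While (TNot (TNat (Reg 1) (Reg 7))) body)
  (Seq (SetReg 0 (Reg 5)) (SetReg 1 (Reg 4)))))).

(** * Correctness and running time *)

Section Correctness.
Variables (R : realType) (n m k : nat) (u : 'I_n -> {set 'I_m} -> R).
Hypothesis umono : forall a, monotonic (u a).
Implicit Types (own : 'I_n -> 'I_k) (al : 'I_m -> 'I_k) (s : state R).

(** * Memory representation of a partial allocation *)

Definition own_base := k + k + k + m.
Definition vec_base := own_base + n.

Record consts s r : Prop := Consts {
  reg0 : regs s 0 = n;
  reg1 : regs s 1 = m;
  reg2 : regs s 2 = k;
  reg3 : regs s 3 = k + k;
  reg4 : regs s 4 = k + k + k;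
  reg5 : regs s 5 = own_base;
  reg6 : regs s 6 = vec_base;
  reg7 : regs s 7 = r
}.

(** With [b] equal to 8 it protects the registers listed in [consts]; with 10, also the results and
    the counter of [search]. *)
Definition frame b (f f' : nat -> nat) := forall x, x < b -> f' x = f x.

Lemma frame_upd b f f' x v : b <= x -> frame b f f' -> frame b f (upd f' x v).
Proof. by move=> bx fr y yb; rewrite upd_neq ?fr //; lia. Qed.

Lemma frame_weaken b c f f' : b <= c -> frame c f f' -> frame b f f'.
Proof. by move=> bc fr x xb; apply: fr; lia. Qed.

Lemma frame_trans b f1 f2 f3 : frame b f1 f2 -> frame b f2 f3 -> frame b f1 f3.
Proof. by move=> fr1 fr2 x xb; rewrite fr2 ?fr1. Qed.

Lemma consts_frame s s' r : frame 8 (regs s) (regs s') -> consts s r -> consts s' r.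
Proof. by move=> fr [*]; split; rewrite fr. Qed.

Record rep (M : nat -> nat) own al r : Prop := Rep {
  rep_own : forall a : 'I_n, M (own_base + a) = own a;
  rep_ptr : forall j : 'I_k, M (k + j) = vec_base + j * m;
  rep_good : forall g : 'I_m, g < r -> M (k + k + k + g) = al g;
  rep_vec : forall (j : 'I_k) (g : 'I_m),
    (M (vec_base + j * m + g) != 0) = (g < r) && (al g == j)
}.

Lemma rep_bundle M own al r (j : 'I_k) : rep M own al r ->
  [set g : 'I_m | M (vec_base + j * m + g) != 0] = bundle al r j.
Proof. by move=> rp; apply/setP => g; rewrite !inE (rep_vec rp). Qed.

Lemma rep_upd_envier M own al r (j : 'I_k) v :
  rep M own al r -> rep (upd M (k + k + j) v) own al r.
Proof.
have jk := ltn_ord j.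
case=> ro rp rg rv; split=> [a|i|g gr|i g]; rewrite upd_neq //.
- by rewrite /own_base; lia.
- by have := ltn_ord i; lia.
- exact: rg.
- lia.
- by rewrite /vec_base /own_base; lia.
Qed.

Lemma rep_upd_own M own al r (a : 'I_n) (j : 'I_k) v :
  v = j -> rep M own al r ->
  rep (upd M (own_base + a) v) (move own a j) al r.
Proof.
have an := ltn_ord a.
move=> ->; case=> ro rp rg rv; split=> [b|i|g gr|i g].
- rewrite /move; have [->|nba] := eqVneq b a; first by rewrite upd_eq.
  rewrite upd_neq // => /addnI /val_inj eba.
  by rewrite eba eqxx in nba.
- by rewrite upd_neq // /own_base; have := ltn_ord i; lia.
- by rewrite upd_neq ?rg // /own_base; have := ltn_ord g; lia.
- by rewrite upd_neq // /vec_base; lia.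
Qed.

(** Uniqueness of Euclidean division: the characteristic vectors occupy disjoint blocks. *)
Lemma mulnD_inj i j h g : h < m -> g < m -> i * m + h = j * m + g ->
  i = j /\ h = g.
Proof.
move=> hm gm e; have m0 : 0 < m by lia.
have eij : i = j.
  by have := congr1 (divn^~ m) e; rewrite !divnMDl // !divn_small // !addn0.
by split=> //; move: e; rewrite eij => /addnI.
Qed.

Lemma rep_give M own al (g : 'I_m) (j : 'I_k) :
  rep M own al g ->
  rep (upd (upd M (vec_base + j * m + g) 1) (k + k + k + g) j)
    own (give al g j) g.+1.
Proof.
have gm := ltn_ord g; have jk := ltn_ord j.
case=> ro rp rg rv; split=> [a|i|h hg|i h].
- by have an := ltn_ord a; rewrite !upd_neq // /vec_base /own_base; lia.
- by have ik := ltn_ord i; rewrite !upd_neq // /vec_base /own_base; lia.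
- rewrite /give; have [->|nhg] := eqVneq h g; first by rewrite upd_eq.
  have nhg' : h <> g :> nat by move/val_inj/eqP; rewrite (negPf nhg).
  have hm := ltn_ord h.
  by rewrite !upd_neq ?rg // /vec_base /own_base; lia.
- have hm := ltn_ord h.
  rewrite upd_neq; last by rewrite /vec_base /own_base; lia.
  have [/andP[/eqP-> /eqP->]|nij] := boolP ((i == j) && (h == g)).
    by rewrite upd_eq // /give !eqxx ltnSn.
  rewrite upd_neq ?rv => [|eqij]; last first.
    have [eij ehg] : i = j :> nat /\ h = g :> nat by apply: mulnD_inj => //; lia.
    by rewrite (val_inj eij) (val_inj ehg) !eqxx in nij.
  rewrite /give ltnS; have [ehg|nhg] := eqVneq h g; last first.
    by congr andb; move: nhg; rewrite -(inj_eq val_inj) /=; lia.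
  by move: nij; rewrite ehg eqxx andbT ltnn eq_sym => /negPf ->; rewrite andbF.
Qed.



(** * One round: search, placement, walk and rotation *)

Lemma wp_scan s own al r (j : 'I_k) Q :
  consts s r -> rep (mem s) own al r -> regs s 9 = j ->
  (forall s' t, t <= 8 * n + 3 -> mem s' = mem s -> frame 10 (regs s) (regs s') ->
     (regs s' 10 = n /\ (forall a, ~~ envies u own (bundle al r) a j)) \/
     (exists2 a : 'I_n, regs s' 10 = a & envies u own (bundle al r) a j) ->
     Q s' t) ->
  wp u scan s Q.
Proof.
move=> cs rp s9 post; apply/wp_seq/wp_setreg.
(* The second alternative does not mention [i]: register 10 is only ever overwritten by another
   envying agent. *)
pose Inv i s' := [/\ mem s' = mem s, frame 10 (regs s) (regs s') &
  (regs s' 10 = n /\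
     (forall a : 'I_n, a < i -> ~~ envies u own (bundle al r) a j)) \/
  (exists2 a : 'I_n, regs s' 10 = a & envies u own (bundle al r) a j)].
apply: (@wp_for _ _ _ _ Inv n 6) => [i s1 [_ fr _]|i s1 ltin r11 [ms fr found]| |].
- by rewrite /= fr // (reg0 cs).
- apply/wp_seq/(@wp_query _ _ _ _ _ _ _ _ (Ordinal ltin)) => /=; first exact: r11.
  rewrite !ms r11 !fr // (reg5 cs) (reg2 cs) (rep_own rp (Ordinal ltin)).
  rewrite (rep_ptr rp) (rep_bundle _ rp).
  apply/wp_seq/(@wp_query _ _ _ _ _ _ _ _ (Ordinal ltin)) => /=; first exact: r11.
  rewrite !fr // (reg2 cs) s9 (rep_ptr rp) (rep_bundle _ rp).
  apply: wp_if => /=; rewrite /upd /= => tst.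
    apply: wp_skip; split=> //; split=> //=; first exact: frame_upd.
    case: found => [[r10 none]|]; [left; split=> // a lta|by right].
    have [lt_ai|] := ltnP a i; first exact: none.
    move=> le_ia; have -> : a = Ordinal ltin by apply: val_inj => /=; lia.
    by rewrite /envies -leNgt.
  apply: wp_setreg; split=> //; split=> //=.
    by apply: frame_upd => //; apply: frame_upd.
  right; exists (Ordinal ltin); first by rewrite /upd /= r11.
  by rewrite /envies ltNge.
- split=> //=; first by do 2!apply: frame_upd => //.
  by left; split=> //; rewrite /upd /= (reg0 cs).
- move=> s1 t [ms fr found] tb; apply: post => //; first lia.
  case: found => [[r10 none]|]; [left|by right].
  by split=> // a; apply: none.
Qed.

Lemma wp_search s own al r Q :
  consts s r -> rep (mem s) own al r ->
  (forall s' t, t <= (8 * n + 10) * k + 3 -> frame 8 (regs s) (regs s') ->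
     rep (mem s') own al r ->
     (exists2 j : 'I_k, regs s' 8 = j &
        forall a, ~~ envies u own (bundle al r) a j) \/
     (regs s' 8 = k /\ forall j : 'I_k, exists a : 'I_n,
        mem s' (k + k + j) = a /\ envies u own (bundle al r) a j) ->
     Q s' t) ->
  wp u search s Q.
Proof.
move=> cs rp post; apply/wp_seq/wp_setreg.
pose Inv i s' := [/\ frame 8 (regs s) (regs s'), rep (mem s') own al r &
  (exists2 j : 'I_k, regs s' 8 = j &
     forall a, ~~ envies u own (bundle al r) a j) \/
  (regs s' 8 = k /\ forall j : 'I_k, j < i -> exists a : 'I_n,
     mem s' (k + k + j) = a /\ envies u own (bundle al r) a j)].
apply: (@wp_for _ _ _ _ Inv k (8 * n + 8)) => [i s1 [fr _ _]|i s1 ltik r9 [fr rp1 unen]| |].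
- by rewrite /= fr // (reg2 cs).
- pose j := Ordinal ltik; have cs1 := consts_frame fr cs.
  apply/wp_seq/(wp_scan cs1 rp1 (r9 : regs s1 9 = j)) => s2 t tb ms fr2 found.
  apply/wp_seq/wp_setmem => /=.
  have cs2 : consts s2 r by apply: consts_frame cs1; apply: frame_weaken fr2.
  have e9 : regs s2 9 = j by rewrite fr2.
  rewrite (reg3 cs2) e9 ms.
  have fr02 : frame 8 (regs s) (regs s2) by apply: frame_trans fr _; apply: frame_weaken fr2.
  have rp2 := rep_upd_envier j (regs s2 10) rp1.
  apply: wp_if => /=; rewrite (reg0 cs2) => tst.
    apply: wp_setreg; split; [lia|exact: e9|].
    split=> //=; first by do 2!apply: frame_upd => //.
    left; exists j; first by rewrite /upd /=.
    case: found => [[]//|[a r10]]; first by move: (ltn_ord a); lia.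
  apply: wp_skip; split; [lia|exact: e9|].
  split=> //=; first by apply: frame_upd.
  case: unen => [[i0 r8 none]|[r8 some]]; [left|right].
    by exists i0 => //; rewrite /upd /= fr2.
  split; first by rewrite /upd /= fr2.
  case: found => [[r10]|[a r10 ena]]; first by move: tst; rewrite r10 leqnn.
  move=> i0 lti0; have [->|ni0] := eqVneq i0 j.
    by exists a; split=> //; rewrite upd_eq.
  have ni : i0 <> i :> nat by move=> e; move/eqP: ni0; case; apply: val_inj.
  have [|b [Pb enb]] := some i0; first lia.
  by exists b; split=> //; rewrite upd_neq //=; lia.
- split=> //=; first by do 2!apply: frame_upd => //.
  by right; split=> //; rewrite /upd /= (reg2 cs).
- move=> s1 t [fr1 rp1 unen] tb; apply: post => //; first lia.
  case: unen => [|[r8 some]]; [by left|right].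
  by split=> // j; apply: some.
Qed.

Lemma wp_place s own al (g : 'I_m) (j : 'I_k) Q :
  consts s g -> rep (mem s) own al g -> regs s 8 = j ->
  (forall s' t, t <= 3 -> consts s' g.+1 ->
     rep (mem s') own (give al g j) g.+1 -> Q s' t) ->
  wp u place s Q.
Proof.
move=> cs rp r8 post.
apply/wp_seq/wp_setmem/wp_seq/wp_setmem/wp_setreg => /=.
apply: post => //=.
  by case: (cs) => *; split=> //=; rewrite /upd /= (reg7 cs) addn1.
rewrite (reg2 cs) r8 (rep_ptr rp) (reg7 cs) (reg4 cs); exact: rep_give.
Qed.

Lemma wp_walk s own al r (P : 'I_k -> 'I_n) (j0 : 'I_k) Q :
  consts s r -> rep (mem s) own al r -> val j0 = 0 ->
  (forall j : 'I_k, mem s (k + k + j) = P j) ->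
  (forall s' t, t <= 3 * k + 3 -> frame 8 (regs s) (regs s') -> mem s' = mem s ->
     regs s' 12 = iter k (own \o P) j0 -> Q s' t) ->
  wp u walk s Q.
Proof.
move=> cs rp j00 eP post; apply/wp_seq/wp_setreg.
pose Inv i s' := [/\ frame 8 (regs s) (regs s'), mem s' = mem s &
                     regs s' 12 = iter i (own \o P) j0].
apply: (@wp_for _ _ _ _ Inv k 1) => [i s1 [fr _ _]|i s1 ltik r9 [fr ms r12]| |].
- by rewrite /= fr // (reg2 cs).
- have cs1 := consts_frame fr cs.
  apply: wp_setreg; split=> //; split=> //=; first by do 2!apply: frame_upd => //.
  rewrite /upd /= (reg5 cs1) (reg3 cs1) ms r12 eP (rep_own rp).
  by [].
- by split=> //=; do 2!apply: frame_upd => //.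
- by move=> s1 t [fr ms r12] tb; apply: post => //; lia.
Qed.

Lemma wp_rotate_step s own al r (P : 'I_k -> 'I_n) (j : 'I_k) Q :
  consts s r -> rep (mem s) own al r ->
  (forall j : 'I_k, mem s (k + k + j) = P j) -> regs s 12 = j ->
  (forall s' t, t <= 4 -> frame 8 (regs s) (regs s') ->
     rep (mem s') (move own (P j) j) al r ->
     (forall j : 'I_k, mem s' (k + k + j) = P j) ->
     regs s' 12 = own (P j) -> regs s' 14 = regs s 14 -> Q s' t) ->
  wp u rotate_step s Q.
Proof.
move=> cs rp eP r12 post.
apply/wp_seq/wp_setreg/wp_seq/wp_setreg/wp_seq/wp_setmem/wp_setreg => /=.
rewrite /upd /= -/(upd _ _ _) r12 (reg3 cs) eP (reg5 cs).
apply: post => //=.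
- by do 3!apply: frame_upd => //.
- exact: rep_upd_own.
- move=> i; case: eqP => [|_]; last exact: eP.
  by rewrite /own_base; have := ltn_ord i; lia.
- by rewrite /upd /= (rep_own rp).
Qed.

(** The loop stops at the first return to [x], which is step [L] by minimality. The table of enviers
    is not refreshed during the rotation. *)
Lemma wp_rotate s own al r (P : 'I_k -> 'I_n) (x : 'I_k) L Q :
  consts s r -> rep (mem s) own al r ->
  (forall j : 'I_k, mem s (k + k + j) = P j) -> regs s 12 = x ->
  0 < L -> iter L (own \o P) x = x ->
  (forall l, 0 < l < L -> iter l (own \o P) x != x) ->
  (forall s' t, t <= 5 * L + 1 -> frame 8 (regs s) (regs s') ->
     rep (mem s') (rotated own P x L) al r -> Q s' t) ->
  wp u rotate s Q.
Proof.
move=> cs rp eP r12 L0 LE Lmin post; set f := own \o P in LE Lmin.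
pose Inv d s' := exists2 l, 0 < l <= L /\ d = L - l &
  [/\ frame 8 (regs s) (regs s'), rep (mem s') (rotated own P x l) al r,
      (forall j : 'I_k, mem s' (k + k + j) = P j),
      regs s' 12 = iter l f x & regs s' 14 = x].
apply/wp_seq/wp_setreg/wp_seq => /=.
apply: (@wp_rotate_step _ own al r P x) => //.
  by apply: consts_frame cs; apply: frame_upd.
move=> s1 t1 t1b fr1 rp1 eP1 r12' r14.
have fr01 : frame 8 (regs s) (regs s1).
  by apply: frame_trans fr1; apply: frame_upd.
apply: (@wp_while _ _ _ _ Inv _ _ 4 (L - 1)) => [d s2 [l [lL ->]]| |].
- move=> [fr2 rp2 eP2 s2_12 s2_14] /=; rewrite s2_12 s2_14 -eqn_leq => nx.
  have ltlL : l < L.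
    case/andP: lL => _ lL; rewrite ltn_neqAle lL andbT.
    by apply: contraNneq nx => ->; rewrite LE.
  apply: (wp_rotate_step (consts_frame fr2 cs) rp2 eP2 s2_12).
  move=> s3 t3 t3b fr3 rp3 eP3 s3_12 s3_14; split=> //.
  exists (L - l.+1); first lia.
  exists l.+1; first by split=> //; lia.
  split=> //; first exact: frame_trans fr3.
    (* The agent read from the table has not moved yet, so her group in memory is the next bundle of
       the original cycle. *)
    by rewrite s3_12 (@rotated_unmoved _ _ own P x L) ?leqnn.
  by rewrite s3_14.
- exists 1; first by rewrite L0.
  by split=> //; rewrite r14 /= upd_eq.
- move=> s2 t2 d [l [lL _]] [fr2 rp2 eP2 s2_12 s2_14] /=.
  rewrite s2_12 s2_14 -eqn_leq negbK => /eqP/val_inj lx tb.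
  apply: post => //; first lia.
  have -> // : L = l.
  apply/eqP; rewrite eqn_leq; case/andP: lL => l0 ->; rewrite andbT leqNgt.
  by apply/negP => lL; have := Lmin l; rewrite l0 lL lx eqxx => /(_ isT).
Qed.

Record good_state (sz : 'I_k -> nat) own al r : Prop := GoodState {
  good_size : forall i, #|[set a | own a == i]| = sz i;
  good_ef1 : ef1 u own (bundle al r)
}.

(* [d] bounds the number of remaining rounds: giving a good adds at most [n]
   envy pairs, and a rotation removes at least one. *)
Definition main_inv sz d s := exists own al r,
  [/\ consts s r, rep (mem s) own al r, r <= m, good_state sz own al r &
      d = (m - r) * n.+1 + envy_count u own (bundle al r)].

Lemma wp_body sz d s : 0 < k ->
  main_inv sz d s -> holds s (TNot (TNat (Reg 1) (Reg 7))) ->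
  wp u body s (fun s' t => t <= (8 * n + 18) * k + 12 /\
                           exists2 d', d' < d & main_inv sz d' s').
Proof.
move=> k0 [own [al [r [cs rp rm [gsz gef] ->]]]] /=.
rewrite (reg1 cs) (reg7 cs) -ltnNge => ltrm.
apply/wp_seq/(wp_search cs rp) => s1 t1 t1b fr1 rp1 found.
have cs1 := consts_frame fr1 cs.
case: found => [[j r8 none]|[r8 some]]; apply: wp_if => /=;
  rewrite (reg2 cs1) r8 ?leqnn //; first by rewrite leqNgt ltn_ord.
  move=> _; apply: (@wp_place _ own al (Ordinal ltrm) j) => //.
  move=> s2 t2 t2b cs2 rp2; split; first lia.
  have cnt := envy_count_give own al (Ordinal ltrm) j umono.
  eexists; last first.
    exists own, (give al (Ordinal ltrm) j), r.+1; split=> //.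
    split=> //; exact: (ef1_give umono (g := Ordinal ltrm)).
  (* One good fewer frees [n.+1] units of the measure, and new envy takes back at most [n]. *)
  have -> : m - r = (m - r.+1).+1 by lia.
  by rewrite mulSn; move: cnt => /=; lia.
move=> _; have /fin_all_exists[P PE] := some.
have eP (j : 'I_k) : mem s1 (k + k + j) = P j by case: (PE j).
have Penv (j : 'I_k) : envies u own (bundle al r) (P j) j by case: (PE j).
pose x := iter k (own \o P) (Ordinal k0).
have exL : exists L, (0 < L) && (iter L (own \o P) x == x).
  have [L /andP[L0 _] LE] := iter_card_periodic (own \o P) (Ordinal k0).
  by exists L; rewrite L0; apply/eqP.
(* The least period makes the cycle simple; comparing it with the period from the pigeonhole
   argument gives [L <= k]. *)
have [L /andP[L0 /eqP LE] Lmin] := ex_minnP exL.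
have Lk : L <= k.
  have [L' /andP[L0' Lk'] LE'] := iter_card_periodic (own \o P) (Ordinal k0).
  by apply: leq_trans Lk'; apply: Lmin; rewrite L0' LE' eqxx.
apply/wp_seq/(@wp_walk _ own al r P (Ordinal k0)) => // s2 t2 t2b fr2 ms2 r12.
have cs2 := consts_frame fr2 cs1.
have Lmin' l : 0 < l < L -> iter l (own \o P) x != x.
  move=> /andP[l0 lL]; apply/negP => e.
  by have := Lmin l; rewrite l0 e => /(_ isT); rewrite leqNgt lL.
apply: (@wp_rotate _ own al r P x L) => //; rewrite ?ms2 //.
move=> s3 t3 t3b fr3 rp3; split; first lia.
have cnt := envy_count_rotated Penv L0 LE Lmin' (leqnn L).
eexists; last first.
  exists (rotated own P x L), al, r; split=> //.
    exact: consts_frame cs2.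
  split; last exact: (ef1_rotated Penv L0 LE Lmin').
  by move=> i; rewrite (card_rotated_period L0 LE Lmin').
by rewrite /= in cnt *; lia.
Qed.

(** * Initialisation and the whole program *)

Lemma wp_set_bases s Q :
  regs s 0 = n -> regs s 1 = m -> regs s 2 = k -> regs s 7 = 0 ->
  (forall s', consts s' 0 -> mem s' = mem s -> Q s' 4) ->
  wp u set_bases s Q.
Proof.
move=> r0 r1 r2 r7 post.
apply/wp_seq/wp_setreg/wp_seq/wp_setreg/wp_seq/wp_setreg/wp_setreg => /=.
apply: post => //; split; rewrite /upd //= ?r0 ?r1 ?r2 //.
Qed.

Lemma wp_set_pointers s r Q : consts s r ->
  (forall s' t, t <= 4 * k + 3 -> consts s' r ->
     (forall j : 'I_k, mem s' (k + j) = vec_base + j * m) ->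
     (forall x, x < k \/ k + k <= x -> mem s' x = mem s x) -> Q s' t) ->
  wp u set_pointers s Q.
Proof.
move=> cs post; apply/wp_seq/wp_setreg.
pose Inv i s' := [/\ frame 8 (regs s) (regs s'), regs s' 13 = vec_base + i * m,
  forall j, j < i -> mem s' (k + j) = vec_base + j * m &
  forall x, x < k \/ k + k <= x -> mem s' x = mem s x].
apply: (@wp_for _ _ _ _ Inv k 2) => [i s1 [fr _ _ _]|i s1 ltik r9 [fr r13 ptr out]| |].
- by rewrite /= fr // (reg2 cs).
- have cs1 := consts_frame fr cs.
  apply/wp_seq/wp_setmem/wp_setreg; split=> //; split=> /=.
  + by do 2!apply: frame_upd => //.
  + by rewrite /upd /= r13 (reg1 cs1); lia.
  + move=> j lj; rewrite (reg2 cs1) r9 r13.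
    have [->|nji] := eqVneq j i; first by rewrite upd_eq.
    by rewrite upd_neq ?ptr //; lia.
  + by move=> x xout; rewrite (reg2 cs1) r9 upd_neq ?out //; lia.
- split=> //=; first by do 2!apply: frame_upd => //.
  by rewrite /upd /= (reg6 cs); lia.
- move=> s1 t [fr r13 ptr out] tb; apply: post => //; first lia.
    exact: consts_frame cs.
  by move=> j; apply: ptr.
Qed.

(** Counting over naturals lets a loop invariant speak of the prefix of the array filled so far. *)
Definition tally (M : nat -> nat) p v :=
  count (fun a => M (own_base + a) == v) (iota 0 p).

Lemma tally_upd M p v w :
  tally (upd M (own_base + p) w) p.+1 v = tally M p v + (w == v).
Proof.
rewrite /tally -addn1 iotaD count_cat /= add0n upd_eq // addn0; congr (_ + _).
apply: eq_in_count => a; rewrite mem_iota => ap.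
by rewrite upd_neq //; lia.
Qed.

Lemma wp_assign_agents s r (sz : nat -> nat) Q : consts s r ->
  (forall i, i < k -> mem s i = sz i) -> \sum_(0 <= i < k) sz i = n ->
  (forall s' t, t <= (4 * n + 4) * k + 3 -> consts s' r ->
     (forall v, tally (mem s') n v = if v < k then sz v else 0) ->
     (forall x, x < own_base \/ vec_base <= x -> mem s' x = mem s x) -> Q s' t) ->
  wp u assign_agents s Q.
Proof.
move=> cs memsz sumsz post; apply/wp_seq/wp_setreg.
pose pos i := \sum_(0 <= j < i) sz j.
have posS i : pos i.+1 = pos i + sz i by rewrite /pos big_nat_recr.
have pos_le i : i <= k -> pos i <= n.
  by move=> ik; rewrite -sumsz (@big_cat_nat _ _ _ i) //= leq_addr.
pose out M := forall x, x < own_base \/ vec_base <= x -> M x = mem s x.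
pose Inv i s' := [/\ frame 8 (regs s) (regs s'), out (mem s'), regs s' 12 = pos i &
  forall v, tally (mem s') (pos i) v = if v < i then sz v else 0].
apply: (@wp_for _ _ _ _ Inv k (4 * n + 2)) => [i s1 [fr _ _ _]|i s1 ltik r9 [fr o1 r12 cnt]| |].
- by rewrite /= fr // (reg2 cs).
(* Register 9 and the low memory must be preserved since the inner bound [Mem (Reg 9)] is read again
   at every test. *)
- pose Inv2 c s' := [/\ frame 8 (regs s) (regs s') /\ regs s' 9 = i, out (mem s'),
    regs s' 12 = pos i + c &
    forall v, tally (mem s') (pos i + c) v = if v < i then sz v else (v == i) * c].
  have szn : sz i <= n by have := pos_le i.+1 ltik; rewrite posS; lia.
  apply: (@wp_for _ _ _ _ Inv2 (sz i) 2) => [c s2 [[_ r9'] o2 _ _]|c s2 ltc r11 [[fr2 r9'] o2 r12' cnt']| |].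
  + by rewrite /= r9' o2 ?memsz //; left; rewrite /own_base; lia.
  + have cs2 := consts_frame fr2 cs.
    have posn : pos i + c < n by have := pos_le i.+1 ltik; rewrite posS; lia.
    apply/wp_seq/wp_setmem/wp_setreg; split=> //.
    split=> /=; first by split=> //; do 2!apply: frame_upd => //.
    * move=> x xout; rewrite (reg5 cs2) r12' upd_neq ?o2 //.
      by move: xout; rewrite /vec_base; lia.
    * by rewrite /upd /= r12'; lia.
    * move=> v; rewrite (reg5 cs2) r12' r9' addnS tally_upd cnt' (eq_sym i).
      by case: (ltngtP v i); lia.
  + split=> //=; first by split=> //; apply: frame_upd.
      by rewrite /upd /= addn0.
    by move=> v; rewrite addn0 muln0 cnt.
  + move=> s2 t [[fr2 r9'] o2 r12' cnt'] tb; split=> //; first by lia.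
    split=> /=; [by apply: frame_upd|by []|by rewrite /upd /= r12' posS|].
    move=> v; rewrite posS cnt' ltnS.
    by case: (ltngtP v i) => //= ->; rewrite mul1n.
- split=> //=; first by do 2!apply: frame_upd => //.
    by rewrite /upd /= /pos big_geq.
  by move=> v; rewrite /pos big_geq.
- move=> s1 t [fr o1 r12 cnt] tb; apply: post => //; first lia.
    exact: consts_frame cs.
  by move=> v; rewrite -[n in tally _ n]sumsz.
Qed.

Lemma tallyE M v : tally M n v = #|[set a : 'I_n | M (own_base + a) == v]|.
Proof.
have -> : tally M n v = \sum_(0 <= a < n | M (own_base + a) == v) 1.
  by rewrite sum1_count /index_iota subn0.
by rewrite big_mkord sum1dep_card.
Qed.

(** Every agent contributes to the tally of the value in her cell; that tally is nonzero, so the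
    value is below [k]. *)
Lemma exists_own M (sz : nat -> nat) : 0 < k ->
  (forall v, tally M n v = if v < k then sz v else 0) ->
  exists own, (forall a : 'I_n, M (own_base + a) = own a) /\
              (forall i : 'I_k, #|[set a | own a == i]| = sz i).
Proof.
move=> k0 cnt.
have lt_k (a : 'I_n) : M (own_base + a) < k.
  have : 0 < tally M n (M (own_base + a)).
    by rewrite tallyE; apply/card_gt0P; exists a; rewrite inE.
  by rewrite cnt; case: ifP.
exists (fun a => Ordinal (lt_k a)); split=> // i.
have := cnt i; rewrite ltn_ord tallyE => <-.
by apply: eq_card => a; rewrite !inE -(inj_eq val_inj).
Qed.

Lemma wp_envy_cycle_elimination s (sz : nat -> nat) Q : 0 < k ->
  (forall a, normalized (u a)) ->
  regs s 0 = n -> regs s 1 = m -> regs s 2 = k -> regs s 7 = 0 ->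
  (forall i, i < k -> mem s i = sz i) -> (forall x, k <= x -> mem s x = 0) ->
  \sum_(0 <= i < k) sz i = n ->
  (forall s' t own al, 
     t <= m * n.+1 * ((8 * n + 18) * k + 13) + (4 * n + 8) * k + 13 ->
     (forall a : 'I_n, mem s' (regs s' 0 + a) = own a) ->
     (forall g : 'I_m, mem s' (regs s' 1 + g) = al g) ->
     good_state sz own al m -> Q s' t) ->
  wp u envy_cycle_elimination s Q.
Proof.
move=> k0 u0 r0 r1 r2 r7 memsz mem0 sumsz post.
apply/wp_seq/wp_set_bases => // s1 cs1 ms1.
apply/wp_seq/(wp_assign_agents (sz := sz) cs1) => //; first by move=> i ik; rewrite ms1 memsz.
move=> s2 t2 t2b cs2 cnt out2.
apply/wp_seq/(wp_set_pointers cs2) => s3 t3 t3b cs3 ptr out3.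
have [own [ownE own_sz]] := exists_own k0 cnt.
(* Arbitrary, as no good is allocated yet. *)
pose al (g : 'I_m) := Ordinal k0.
(* Both initialisation loops write below [vec_base], so the vectors keep their initial zeros and
   encode empty bundles. *)
have zero j (g : 'I_m) : mem s3 (vec_base + j * m + g) = 0.
  by rewrite out3 ?out2 ?ms1 ?mem0 //; rewrite /vec_base /own_base; lia.
have rp : rep (mem s3) own al 0.
  split=> // [a|j g]; last by rewrite zero.
  by rewrite out3 ?ownE // /own_base; lia.
have inv : main_inv sz (m * n.+1) s3.
  exists own, al, 0; split=> //; last by rewrite subn0 envy_count_empty addn0.
  by split=> //; apply: ef1_empty.
apply/wp_seq/(wp_while (fun d s => @wp_body sz d s k0) inv) => s4 t4 d [own4 [al4 [r [cs4 rp4 rm gs4 _]]]].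
rewrite /= (reg1 cs4) (reg7 cs4) negbK => mr t4b.
have er : r = m by apply/eqP; rewrite eqn_leq rm.
subst r; apply/wp_seq/wp_setreg/wp_setreg.
apply: (post _ _ own4 al4) => //=; first by lia.
- by move=> a; rewrite /upd /= (reg5 cs4) (rep_own rp4).
- by move=> g; rewrite /upd /= (reg4 cs4) (rep_good rp4).
Qed.

End Correctness.

(** * The cubic bound and its application to instances *)

(** Bounding [k] by [n] and lower-order terms by squares gives 8 + 18 + 13 = 39 per round and 4 + 8
    + 13 = 25 outside the rounds; as [n.+1 <= 2 * n], the total is 2 * 39 + 25 = 103. A positive [m]
    absorbs the quadratic cost outside the rounds. *)
Lemma leq_running_time n m k : 0 < m -> k <= n -> 0 < n ->
  m * n.+1 * ((8 * n + 18) * k + 13) + (4 * n + 8) * k + 13 <= 103 * (m * n ^ 3).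
Proof.
move=> m0 kn n0.
have body_le : (8 * n + 18) * k + 13 <= 39 * (n * n) by nia.
have init_le : (4 * n + 8) * k + 13 <= 25 * (n * n) by nia.
have nn_le : n * n <= m * n ^ 3.
  by rewrite !expnS expn0 muln1; apply: leq_trans (leq_pmull _ m0); rewrite leq_pmull.
have main_le : m * n.+1 * ((8 * n + 18) * k + 13) <= m * (2 * n) * (39 * (n * n)).
  by apply: leq_mul => //; rewrite leq_mul2l; lia.
have e : m * (2 * n) * (39 * (n * n)) = 78 * (m * n ^ 3) by rewrite !expnS expn0; nia.
lia.
Qed.

Section Instance.
Variables (R : realType) (I : instance R).

Lemma groups_gt0 : 0 < groups I.
Proof. exact: ltn_trans (groups_ge2 I). Qed.

Lemma groups_leq_agents : groups I <= agents I.
Proof.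
rewrite (agentsE I) -[X in X <= _]card_ord -sum1_card.
by apply: leq_sum => i _; apply: group_size_gt0.
Qed.

Lemma envy_cycle_elimination_correct :
  exists (s : state R) (t : nat),
    [/\ exec (@utility R I) envy_cycle_elimination (input I) s t,
        is_outcome (output_groups I s) (output_bundles I s),
        EF 1 (output_groups I s) (output_bundles I s) &
        0 < goods I -> t <= 103 * (goods I * agents I ^ 3)].
Proof.
(* The very function that fills the memory in [input], with default 0 from [groups I] on. *)
pose sz x := oapp (@group_size R I) 0 (insub x).
have szE (i : 'I_(groups I)) : sz i = group_size i by rewrite /sz valK.
suff [s [t [ex [out ef tb]]]] : wp (@utility R I) envy_cycle_elimination (input I)
    (fun s t => [/\ is_outcome (output_groups I s) (output_bundles I s),
        EF 1 (output_groups I s) (output_bundles I s) &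
        0 < goods I -> t <= 103 * (goods I * agents I ^ 3)]).
  by exists s, t.
apply: (@wp_envy_cycle_elimination _ _ _ (groups I) _ _ (input I) sz) => //.
- exact: utility_monotonic.
- exact: groups_gt0.
- exact: utility_normalized.
- by move=> x kx /=; rewrite insubF // ltnNge kx.
- by rewrite big_mkord (agentsE I); apply: eq_bigr.
move=> s t own al tb ownE alE [own_sz ef].
have grE i : output_groups I s i = [set a | own a == i].
  by apply/setP => a; rewrite !inE ownE -(inj_eq val_inj).
have buE i : output_bundles I s i = bundle al (goods I) i.
  by apply/setP => g; rewrite !inE alE ltn_ord -(inj_eq val_inj).
split.
- split.
  + split=> [i j nij||i].
    * rewrite !grE -setI_eq0; apply/eqP/setP => a; rewrite !inE.
      by case: eqP => // ->; rewrite (negPf nij).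
    * by apply/setP => a; rewrite inE; apply/bigcupP; exists (own a); rewrite // grE inE.
    * by rewrite grE own_sz szE.
  + move=> i j nij; rewrite !buE -setI_eq0; apply/eqP/setP => g; rewrite !inE ltn_ord /=.
    by case: eqP => // ->; rewrite (negPf nij).
  + by apply/setP => g; rewrite inE; apply/bigcupP; exists (al g); rewrite // buE inE ltn_ord /=.
- move=> i j a; rewrite grE inE => /eqP <-.
  by have [B [sB cB leB]] := ef a j; exists B; rewrite !buE.
- move=> m0; apply: leq_trans tb _; apply: leq_running_time => //.
    exact: groups_leq_agents.
  exact: leq_trans groups_gt0 groups_leq_agents.
Qed.

End Instance.

Theorem theorem1 (R : realType) :
  (forall I : instance R,
     exists (C : 'I_(groups I) -> {set 'I_(agents I)})
            (A : 'I_(groups I) -> {set 'I_(goods I)}),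
       is_outcome C A /\ EF 1 C A)
  /\
  (exists (p : prog) (c : nat), forall I : instance R,
     exists (s : state R) (t : nat),
       [/\ exec (@utility R I) p (input I) s t,
           is_outcome (output_groups I s) (output_bundles I s),
           EF 1 (output_groups I s) (output_bundles I s) &
           0 < goods I -> t <= c * (goods I * agents I ^ 3)]).
Proof.
split=> [I|].
  have [s [t [_ out ef _]]] := envy_cycle_elimination_correct I.
  by exists (output_groups I s), (output_bundles I s).
exists envy_cycle_elimination, 103; exact: envy_cycle_elimination_correct.
Qed.
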